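(* For all integers $n\ge 1$ and $d\ge 2$ one has $l_d^\circ(n)=\max\left(1,\frac{n}{2^d}\right)\cdot\lambda_d(B_d)$.
   Context: $\lambda_d$ denotes Lebesgue measure on $\mathbb{R}^d$ and $\lambda_1$ the one-dimensional Lebesgue measure (length) on a line. $B_d\subset\mathbb{R}^d$ is the open ball of diameter $1$ centered at the origin. $l^\circ_d(n)$ is the supremum of $\lambda_d(\mathcal{P})$ over all sets $\mathcal{P}\subset\mathbb{R}^d$ that are unions of $n$ pairwise disjoint nonempty $d$-dimensional open balls of diameter at most $1$ each, such that $\lambda_1(\mathcal{P}\cap\mathcal{L})\le 1$ for every line $\mathcal{L}\subset\mathbb{R}^d$. *)

(* Defs.v *)
From mathcomp Require Import all_boot all_order all_algebra.
From mathcomp Require Import all_classical all_reals all_analysis.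
Set Implicit Arguments.
Unset Strict Implicit.
Unset Printing Implicit Defensive.
Import Order.TTheory GRing.Theory Num.Theory.
Import numFieldNormedType.Exports.
Local Open Scope classical_set_scope.
Local Open Scope ring_scope.

(* The library's norm on 'rV_d is the sup norm, hence an explicit Euclidean
   one. *)
Definition enorm (R : realType) (d : nat) (x : 'rV[R]_d) : R :=
  Num.sqrt (\sum_(i < d) x ord0 i ^+ 2).

(* Parametrized by the diameter [s], not by the radius. *)
Definition oball (R : realType) (d : nat) (c : 'rV[R]_d) (s : R) :
    set 'rV[R]_d :=
  [set x | enorm (x - c) < s / 2].

Definition box (R : realType) (d : nat) (a b : 'rV[R]_d) : set 'rV[R]_d :=
  [set x | forall i, a ord0 i < x ord0 i <= b ord0 i].

Definition box_volume (R : realType) (d : nat) (a b : 'rV[R]_d) : R :=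
  \prod_(i < d) (b ord0 i - a ord0 i).

(* The Lebesgue outer measure: infimum of the total volumes of the countable
   covers by boxes.  It is defined on all sets and coincides with the Lebesgue
   measure on the measurable ones; below it is only applied to open sets.  The
   requirement [a <= b] componentwise keeps [box_volume] nonnegative. *)
Definition lebesgue_d (R : realType) (d : nat) (A : set 'rV[R]_d) : \bar R :=
  ereal_inf [set m : \bar R | exists a b : nat -> 'rV[R]_d,
    [/\ forall k i, a k ord0 i <= b k ord0 i,
        A `<=` \bigcup_k box (a k) (b k)
      & m = (\sum_(0 <= k <oo) (box_volume (a k) (b k))%:E)%E]].

(* Length of the intersection of [A] with the line through [p] directed by [v];
   this is the one-dimensional Lebesgue measure on that line when [v] is a unit
   vector, since then [t |-> p + t *: v] is an isometry onto the line. *)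
Definition line_length (R : realType) (d : nat) (p v : 'rV[R]_d)
    (A : set 'rV[R]_d) : \bar R :=
  lebesgue_measure [set t : R | A (p + t *: v)].

Definition disjoint_ball_union (R : realType) (d n : nat)
    (P : set 'rV[R]_d) : Prop :=
  exists (c : 'I_n -> 'rV[R]_d) (s : 'I_n -> R),
    [/\ forall i, 0 < s i <= 1,
        trivIset setT (fun i => oball (c i) (s i))
      & P = \bigcup_i oball (c i) (s i)].

Definition line_bounded (R : realType) (d : nat) (P : set 'rV[R]_d) : Prop :=
  forall p v : 'rV[R]_d, enorm v = 1 -> (line_length p v P <= 1)%E.

Definition ell (R : realType) (d n : nat) : \bar R :=
  ereal_sup [set lebesgue_d P | P in
    [set P : set 'rV[R]_d | disjoint_ball_union n P /\ line_bounded P]].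

(* Main.v *)
(** Upper bound: the line through the centres of two of the balls meets them
    in total length [s i + s j], so any two diameters add up to at most [1].
    If all diameters are at most [1/2], then [\sum_i s i ^+ d <= n / 2 ^+ d];
    otherwise one of them is [1 - u / 2] with [0 <= u < 1], the others are at
    most [u / 2], and by convexity [\sum_i s i ^+ d] lies below a convex
    combination of [1] and [n / 2 ^+ d].  Scaling and subadditivity of
    the outer measure conclude.

    Lower bound: one ball of diameter [1 - e] together with [n - 1] balls of
    total diameter at most [e] gives volume arbitrarily close to that of the
    unit-diameter ball.  For [n / 2 ^+ d], take balls of diameter [1/2] centred
    on an exponential curve [(i, K ^+ i)]: its slopes grow so fast that no line
    meets three of them.  Their volumes add up because they lie in disjoint
    slabs, and covers by boxes can be cut along coordinate hyperplanes. *)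

Require Import Defs.
From mathcomp Require Import all_boot all_order all_algebra.
From mathcomp Require Import all_classical all_reals all_analysis.
From mathcomp Require Import ring lra.
Set Implicit Arguments.
Unset Strict Implicit.
Unset Printing Implicit Defensive.
Import Order.TTheory GRing.Theory Num.Theory.
Local Open Scope classical_set_scope.
Local Open Scope ring_scope.

(** * Infima and series of nonnegative extended reals *)

(** Two covers chosen independently bound a sum of two outer measures. Nonnegativity excludes [-oo],
    so once the infinite cases are settled, each finite summand can be moved across the inequality
    and the infima taken one after the other. *)
Lemma le_ereal_inf_add (R : realType) (S T : set (\bar R)) (z : \bar R) :
    (forall x, S x -> 0 <= x)%E -> (forall y, T y -> 0 <= y)%E ->
    (forall x y, S x -> T y -> z <= x + y)%E ->
  (z <= ereal_inf S + ereal_inf T)%E.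
Proof.
move=> S0 T0 zST.
have iS0 : (0 <= ereal_inf S)%E by apply/ereal_infP.
have iT0 : (0 <= ereal_inf T)%E by apply/ereal_infP.
have [->|Tfin] := eqVneq (ereal_inf T) +oo%E.
  by rewrite addey ?leey// gt_eqF// (lt_le_trans _ iS0)// ltNy0.
have {}Tfin : ereal_inf T \is a fin_num.
  by rewrite ge0_fin_numE// lt_neqAle Tfin leey.
rewrite -leeBlDr//; apply/ereal_infP => x Sx; rewrite leeBlDr//.
have [->|xfin] := eqVneq x +oo%E.
  by rewrite addye ?leey// gt_eqF// (lt_le_trans _ iT0)// ltNy0.
have {}xfin : x \is a fin_num.
  by rewrite ge0_fin_numE ?S0// lt_neqAle xfin leey.
by rewrite -leeBlDl//; apply/ereal_infP => y Ty; rewrite leeBlDl// zST.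
Qed.

(** Merges two countable covers into one: [u] sits at the even indices and [v] at the odd ones, so
    the first [2N] interleaved terms are exactly the first [N] terms of both series. *)
Lemma nneseries_interleave (R : realType) (u v : (\bar R)^nat) :
    (forall k, 0 <= u k)%E -> (forall k, 0 <= v k)%E ->
  (\sum_(0 <= k <oo) (if odd k then v k./2 else u k./2) <=
   \sum_(0 <= k <oo) u k + \sum_(0 <= k <oo) v k)%E.
Proof.
move=> u0 v0; rewrite -nneseriesD//.
have w0 k : (0 <= if odd k then v k./2 else u k./2)%E by case: odd.
apply: lime_le; first exact: is_cvg_nneseries.
apply: nearW => N; apply: (@le_trans _ _
    (\sum_(0 <= k < N.*2) (if odd k then v k./2 else u k./2))%E).
  by apply: lee_sum_nneg_natr => //; rewrite -addnn leq_addr.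
suff -> : (\sum_(0 <= k < N.*2) (if odd k then v k./2 else u k./2) =
    \sum_(0 <= k < N) (u k + v k))%E.
  by apply: nneseries_lim_ge => k _ _; rewrite adde_ge0.
elim: N => [|N IH]; first by rewrite !big_geq.
rewrite doubleS !big_nat_recr//= IH/= uphalf_double half_double odd_double/=.
by rewrite addeA.
Qed.

(** * The outer measure: scaling, subadditivity, and additivity across slabs *)

Section outer_measure_boxes.
Context {R : realType} {d : nat}.
Implicit Types (A B : set 'rV[R]_d) (a b c x : 'rV[R]_d).

Lemma box_volume_ge0 a b :
  (forall i, a ord0 i <= b ord0 i) -> 0 <= box_volume a b.
Proof. by move=> ab; apply: prodr_ge0 => i _; rewrite subr_ge0. Qed.

Lemma lebesgue_d_le_cover A (a b : nat -> 'rV[R]_d) :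
    (forall k i, a k ord0 i <= b k ord0 i) -> A `<=` \bigcup_k box (a k) (b k) ->
  (lebesgue_d A <= \sum_(0 <= k <oo) (box_volume (a k) (b k))%:E)%E.
Proof. by move=> ab Aab; apply: ereal_inf_lbound; exists a, b. Qed.

Lemma lebesgue_d_ge0 A : (0 <= lebesgue_d A)%E.
Proof.
apply/ereal_infP => _ [a] [b] [ab _ ->].
by apply: nneseries_ge0 => k _ _; rewrite lee_fin box_volume_ge0.
Qed.

Lemma le_lebesgue_d A B : A `<=` B -> (lebesgue_d A <= lebesgue_d B)%E.
Proof.
move=> AB; apply/ereal_infP => _ [a] [b] [ab Bab ->].
by apply: lebesgue_d_le_cover => //; apply: subset_trans Bab.
Qed.

(** A homothety maps a cover by boxes to a cover by boxes and multiplies every volume by [s ^+ d].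
    The converse bound comes from applying this to the inverse homothety. *)
Lemma lebesgue_d_affine_le (c : 'rV[R]_d) (s : R) A : 0 < s ->
  (lebesgue_d [set (c + s *: x)%R | x in A] <= (s ^+ d)%:E * lebesgue_d A)%E.
Proof.
move=> s0; rewrite -lee_pdivrMl ?exprn_gt0//.
apply/ereal_infP => _ [a] [b] [ab Aab ->].
rewrite lee_pdivrMl ?exprn_gt0// -nneseriesZl; last first.
  by move=> k _; rewrite lee_fin box_volume_ge0.
have -> : (\sum_(0 <= k <oo) ((s ^+ d)%:E * (box_volume (a k) (b k))%:E) =
    \sum_(0 <= k <oo) (box_volume (c + s *: a k) (c + s *: b k))%:E)%E.
  apply: eq_eseriesr => k _; rewrite -EFinM; congr (_%:E).
  rewrite -[in s ^+ d](card_ord d) -prodr_const -big_split/=.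
  by apply: eq_bigr => i _; rewrite !mxE; ring.
apply: lebesgue_d_le_cover => [k i|_ [x /Aab[k _ abx] <-]].
  by rewrite !mxE lerD2l ler_pM2l.
by exists k => // i; have /andP[? ?] := abx i;
  rewrite !mxE ltrD2l ltr_pM2l// lerD2l ler_pM2l//; apply/andP.
Qed.

Lemma lebesgue_dU A B : (lebesgue_d (A `|` B) <= lebesgue_d A + lebesgue_d B)%E.
Proof.
apply: le_ereal_inf_add => [_ [a] [b] [ab _ ->]|_ [a] [b] [ab _ ->]|].
- by apply: nneseries_ge0 => k _ _; rewrite lee_fin box_volume_ge0.
- by apply: nneseries_ge0 => k _ _; rewrite lee_fin box_volume_ge0.
move=> _ _ [a] [b] [ab Aab ->] [a'] [b'] [ab' Bab' ->].
apply: le_trans (nneseries_interleave _ _) => [|k|k]; last 2 first.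
- by rewrite lee_fin box_volume_ge0.
- by rewrite lee_fin box_volume_ge0.
pose a2 k := if odd k then a' k./2 else a k./2.
pose b2 k := if odd k then b' k./2 else b k./2.
apply: (@le_trans _ _ (\sum_(0 <= k <oo) (box_volume (a2 k) (b2 k))%:E)%E).
  apply: lebesgue_d_le_cover => [k i|x [/Aab|/Bab'] [k _ xk]].
  - by rewrite /a2 /b2; case: odd.
  - by exists k.*2 => //; rewrite /a2 /b2 odd_double half_double.
  - by exists k.*2.+1 => //; rewrite /a2 /b2 /= odd_double/= uphalf_double.
by apply: lee_nneseries => k *; rewrite /a2 /b2; case: odd;
  rewrite // lee_fin box_volume_ge0.
Qed.

Lemma lebesgue_d_bigcup (n : nat) (F : 'I_n -> set 'rV[R]_d) : (0 < d)%N ->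
  (lebesgue_d (\bigcup_i F i) <= \sum_(i < n) lebesgue_d (F i))%E.
Proof.
move=> d0; elim: n F => [|n IH] F.
  rewrite big_ord0.
  (* The empty union is covered by degenerate boxes; these have volume 0 because [0 < d] makes the
     product of edge lengths nonempty. *)
  apply: (le_trans (@lebesgue_d_le_cover _ (fun=> 0) (fun=> 0) _ _)) => //.
    by move=> x [[]].
  rewrite eseries0// => k _ _.
  by rewrite /box_volume (bigD1 (Ordinal d0))//= subrr mul0r.
rewrite big_ord_recl; apply: le_trans (leeD (le_refl _) (IH (F \o lift ord0))).
apply: le_trans (lebesgue_dU _ _); apply: le_lebesgue_d => x [i _ Fix].
case: (unliftP ord0 i) Fix => [j ->|->] Fx; last by left.
by right; exists j.
Qed.

Lemma lebesgue_d_box_fin a b : (0 < d)%N -> (forall i, a ord0 i <= b ord0 i) ->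
  (lebesgue_d (box a b) < +oo)%E.
Proof.
move=> d0 ab.
(* The cover is the box itself, followed by degenerate boxes of volume 0. *)
apply: (le_lt_trans (@lebesgue_d_le_cover _ (fun k => if k is 0 then a else 0)
   (fun k => if k is 0 then b else 0) _ _)) => [[|k] i//|x xab|].
  by exists 0%N.
rewrite (nneseries_split 0 1)//; last first.
  by move=> [|k] _; rewrite lee_fin box_volume_ge0.
rewrite eseries0 => [|[|k]//= _ _]; last first.
  by rewrite /box_volume (bigD1 (Ordinal d0))//= subrr mul0r.
by rewrite adde0 big_nat1 ltry.
Qed.

(** Carathéodory's inequality for a coordinate half-space and an arbitrary set: the hyperplane cuts
    each box of a cover into two boxes whose volumes add up, and the two families cover the two
    pieces of [A]. *)
Lemma lebesgue_d_cut (i0 : 'I_d) (c : R) A :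
  (lebesgue_d (A `&` [set x | (x ord0 i0 <= c)%R]) +
   lebesgue_d (A `&` [set x | (c < x ord0 i0)%R]) <= lebesgue_d A)%E.
Proof.
apply/ereal_infP => _ [a] [b] [ab Aab ->].
(* [c] clamped to the [i0]-th edge of the [k]-th box *)
pose m k := Num.max (a k ord0 i0) (Num.min (b k ord0 i0) c).
have m_ge k : a k ord0 i0 <= m k by rewrite le_max lexx.
have m_le k : m k <= b k ord0 i0 by rewrite ge_max ab ge_min lexx.
pose upd (x : 'rV[R]_d) (t : R) : 'rV[R]_d :=
  \row_i if i == i0 then t else x ord0 i.
pose b1 k := upd (b k) (m k).
pose a2 k := upd (a k) (m k).
have -> : (\sum_(0 <= k <oo) (box_volume (a k) (b k))%:E =
    \sum_(0 <= k <oo) (box_volume (a k) (b1 k))%:E +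
    \sum_(0 <= k <oo) (box_volume (a2 k) (b k))%:E)%E.
  rewrite -nneseriesD; first last.
  - move=> k _ _; rewrite lee_fin box_volume_ge0// => i; rewrite /a2 mxE.
    by case: eqP => [->|].
  - move=> k _ _; rewrite lee_fin box_volume_ge0// => i; rewrite /b1 mxE.
    by case: eqP => [->|].
  apply: eq_eseriesr => k _; rewrite -EFinD; congr (_%:E).
  rewrite /box_volume !(bigD1 i0 isT)//= !mxE eqxx.
  set p := \prod_(i | _) _.
  have -> : \prod_(i | i != i0) (b1 k ord0 i - a k ord0 i) = p.
    by apply: eq_bigr => i /negPf ii0; rewrite mxE ii0.
  have -> : \prod_(i | i != i0) (b k ord0 i - a2 k ord0 i) = p.
    by apply: eq_bigr => i /negPf ii0; rewrite mxE ii0.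
  by rewrite -mulrDl; congr (_ * _); ring.
apply: leeD; apply: lebesgue_d_le_cover => [k i|x [/Aab[k _ xk] /= xc]].
- by rewrite /b1 mxE; case: eqP => [->|].
- exists k => // i; have /andP[xa xb] := xk i.
  rewrite xa /b1 mxE; case: eqP => [ii0|//]; subst i.
  by rewrite le_max le_min xb xc orbT.
- by rewrite /a2 mxE; case: eqP => [->|].
- exists k => // i; have /andP[xa xb] := xk i.
  rewrite xb andbT /a2 mxE; case: eqP => [ii0|//]; subst i.
  by rewrite gt_max xa gt_min xc orbT.
Qed.

(** Cutting at height [h n] splits off the last set from the earlier ones, which all lie below that
    height; induction does the rest. *)
Lemma lebesgue_d_slabs (i0 : 'I_d) (h : nat -> R) (F : nat -> set 'rV[R]_d)
    (n : nat) :
    nondecreasing_seq h ->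
    (forall k x, F k x -> h k < x ord0 i0 <= h k.+1) ->
  (\sum_(k < n) lebesgue_d (F k) <= lebesgue_d (\bigcup_(k < n) F k))%E.
Proof.
move=> hnd Fh; elim: n => [|n IH]; first by rewrite big_ord0 lebesgue_d_ge0.
rewrite big_ord_recr/=; apply: le_trans (lebesgue_d_cut i0 (h n) _).
apply: leeD.
  apply: le_trans IH _; apply: le_lebesgue_d => x [k /= kn Fkx]; split.
    by exists k => //=; exact: ltnW.
  by have /andP[_ /= /le_trans] := Fh _ _ Fkx; apply; exact: hnd.
apply: le_lebesgue_d => x Fx; split; first by exists n => /=.
by have /andP[] := Fh _ _ Fx.
Qed.

End outer_measure_boxes.

(** * Euclidean balls: their volumes and their intersections with lines *)

Section euclidean_balls.
Context {R : realType} {d : nat}.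
Implicit Types (c p v x : 'rV[R]_d) (s : R).

Lemma sqr_enorm x : enorm x ^+ 2 = \sum_(i < d) x ord0 i ^+ 2.
Proof. by rewrite sqr_sqrtr// sumr_ge0// => i _; rewrite sqr_ge0. Qed.

Lemma enorm_ge0 x : 0 <= enorm x.
Proof. exact: sqrtr_ge0. Qed.

Lemma enormZ s x : enorm (s *: x) = `|s| * enorm x.
Proof.
rewrite -sqrtr_sqr -sqrtrM ?sqr_ge0// /enorm mulr_sumr.
by congr Num.sqrt; apply: eq_bigr => i _; rewrite mxE exprMn.
Qed.

Lemma enorm0 : enorm (0 : 'rV[R]_d) = 0.
Proof. by rewrite -(scale0r 0) enormZ normr0 mul0r. Qed.

Lemma enorm_eq0 x : enorm x = 0 -> x = 0.
Proof.
move=> x0; apply/rowP => i; apply/eqP; rewrite mxE -sqrf_eq0.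
have := sqr_enorm x; rewrite x0 expr0n/= => /esym/psumr_eq0P.
by move=> ->// j _; rewrite sqr_ge0.
Qed.

Lemma coord_le_enorm x i : `|x ord0 i| <= enorm x.
Proof.
rewrite -sqrtr_sqr ler_wsqrtr// (bigD1 i)//= lerDl sumr_ge0// => j _.
by rewrite sqr_ge0.
Qed.

Lemma oball_coord c s x i : oball c s x -> `|x ord0 i - c ord0 i| < s / 2.
Proof. by apply: le_lt_trans; have := coord_le_enorm (x - c) i; rewrite !mxE. Qed.

Lemma oball_center c s : 0 < s -> oball c s c.
Proof. by move=> s0; rewrite /oball/= subrr enorm0 divr_gt0. Qed.

Lemma oball_affine c c' r s : 0 < r ->
  [set (c + r *: x)%R | x in oball c' s] = oball (c + r *: c') (r * s).
Proof.
move=> r0; apply/seteqP; split => [_ [x xs <-]|x xs].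
  rewrite /oball/= opprD addrACA subrr add0r -scalerBr enormZ gtr0_norm//.
  by rewrite -mulrA ltr_pM2l.
exists (r^-1 *: (x - c)); last first.
  by rewrite scalerA divff ?gt_eqF// scale1r addrC subrK.
have xE : x - (c + r *: c') = r *: (r^-1 *: (x - c) - c').
  by rewrite scalerBr scalerA divff ?gt_eqF// scale1r opprD addrA.
by move: xs; rewrite /oball/= xE enormZ gtr0_norm// -mulrA ltr_pM2l.
Qed.

Lemma lebesgue_d_oball c s : 0 < s ->
  lebesgue_d (oball c s) = ((s ^+ d)%:E * lebesgue_d (@oball R d 0 1))%E.
Proof.
move=> s0; apply/eqP; rewrite eq_le; apply/andP; split.
  have := lebesgue_d_affine_le c (@oball R d 0 1) s0.
  by rewrite oball_affine// scaler0 addr0 mulr1.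
rewrite -lee_pdivlMl ?exprn_gt0//.
(* For the reverse inequality, the inverse homothety maps [oball c s] back to the unit-diameter
   ball. *)
have s'0 : 0 < s^-1 by rewrite invr_gt0.
have := lebesgue_d_affine_le (- (s^-1 *: c)) (oball c s) s'0.
by rewrite oball_affine// addNr mulVf ?gt_eqF// exprVn.
Qed.

Lemma lebesgue_d_oball_fin : (0 < d)%N -> lebesgue_d (@oball R d 0 1) \is a fin_num.
Proof.
move=> d0; rewrite ge0_fin_numE ?lebesgue_d_ge0//.
apply: le_lt_trans (@lebesgue_d_box_fin R d (const_mx (-1)) (const_mx 1) d0 _).
  apply: le_lebesgue_d => x x1 i; have := oball_coord i x1.
  by rewrite !mxE ltr_norml => /andP[? ?]; lra.
by move=> i; rewrite !mxE; lra.
Qed.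

(** Pythagoras: the squared distance to [c] at parameter [t] is [(t + b) ^+ 2 + q ^+ 2], where [q]
    is the distance from [c] to the line. The chord is therefore centred at [- b] with half-length
    the square root of [(s / 2) ^+ 2 - q ^+ 2]. If the line misses the ball, that root is 0 and the
    interval is empty. *)
Lemma oball_line_itv c s p v : enorm v = 1 -> 0 <= s ->
  exists m w, [/\ 0 <= w <= s / 2 &
    [set t : R | oball c s (p + t *: v)] = `]m - w, m + w[%classic].
Proof.
move=> v1 s0.
pose b := \sum_(i < d) (p - c) ord0 i * v ord0 i.
pose q := enorm (p - c - b *: v).
have vv : \sum_(i < d) v ord0 i ^+ 2 = 1 by rewrite -sqr_enorm v1 expr1n.
have sqE t : enorm (p + t *: v - c) ^+ 2 = (t + b) ^+ 2 + q ^+ 2.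
  rewrite /q !sqr_enorm.
  transitivity (\sum_(i < d) ((p - c) ord0 i ^+ 2 +
      (t *+ 2) * ((p - c) ord0 i * v ord0 i) + t ^+ 2 * v ord0 i ^+ 2)).
    by apply: eq_bigr => i _; rewrite !mxE; ring.
  rewrite !big_split/= -!mulr_sumr vv -/b.
  have -> : \sum_(i < d) (p - c - b *: v) ord0 i ^+ 2 =
      \sum_(i < d) ((p - c) ord0 i ^+ 2 -
      (b *+ 2) * ((p - c) ord0 i * v ord0 i) + b ^+ 2 * v ord0 i ^+ 2).
    by apply: eq_bigr => i _; rewrite !mxE; ring.
  rewrite !big_split/= sumrN -!mulr_sumr vv -/b; ring.
exists (- b), (Num.sqrt ((s / 2) ^+ 2 - q ^+ 2)); split.
  rewrite sqrtr_ge0/= -[leRHS]ger0_norm ?divr_ge0// -sqrtr_sqr ler_wsqrtr//.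
  by rewrite gerBl sqr_ge0.
have s20 : 0 <= s / 2 by rewrite divr_ge0.
apply/seteqP; split => t /=; rewrite in_itv/= /oball/=.
  rewrite -(ltr_pXn2r (n := 2)) ?nnegrE ?enorm_ge0// sqE -ltrBrDr => tb.
  have : `|t + b| < Num.sqrt ((s / 2) ^+ 2 - q ^+ 2).
    by rewrite -sqrtr_sqr ltr_sqrt// (le_lt_trans _ tb)// sqr_ge0.
  by rewrite ltr_norml => /andP[? ?]; apply/andP; split; lra.
move=> /andP[? ?].
have : `|t + b| < Num.sqrt ((s / 2) ^+ 2 - q ^+ 2).
  by rewrite ltr_norml; apply/andP; split; lra.
have [k0|k0] := ltP 0 ((s / 2) ^+ 2 - q ^+ 2); last first.
  by rewrite ler0_sqrtr// ltNge normr_ge0.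
by rewrite -sqrtr_sqr ltr_sqrt// ltrBrDr -sqE ltr_pXn2r ?nnegrE ?enorm_ge0.
Qed.

Lemma measurable_oball_line c s p v : enorm v = 1 -> 0 <= s ->
  measurable [set t : R | oball c s (p + t *: v)].
Proof. by move=> v1 s0; have [m [w [_ ->]]] := oball_line_itv c p v1 s0. Qed.

Lemma line_length_oball_le c s p v : enorm v = 1 -> 0 <= s ->
  (line_length p v (oball c s) <= s%:E)%E.
Proof.
move=> v1 s0; rewrite /line_length.
have [m [w [/andP[w0 ws] ->]]] := oball_line_itv c p v1 s0.
rewrite lebesgue_measure_itv/=; case: ifP => _; last by rewrite lee_fin.
by rewrite -EFinB lee_fin; lra.
Qed.

(** The offset [r] allows a base point other than the centre, so that one parametrized line can
    serve two balls at once. *)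
Lemma line_length_oball_center c s r v : enorm v = 1 -> 0 <= s ->
  line_length (c - r *: v) v (oball c s) = s%:E.
Proof.
move=> v1 s0; rewrite /line_length.
have -> : [set t : R | oball c s (c - r *: v + t *: v)] = `]r - s / 2, r + s / 2[%classic.
  apply/seteqP; split => t; rewrite /oball/= in_itv/=;
    (have -> : c - r *: v + t *: v - c = (t - r) *: v
      by apply/rowP => i; rewrite !mxE; ring);
    rewrite enormZ v1 mulr1 ltr_norml;
    by move=> /andP[? ?]; apply/andP; split; lra.
rewrite lebesgue_measure_itv/= lte_fin -EFinB.
have [->|s1] := eqVneq s 0; first by rewrite !mul0r subr0 addr0 ltxx.
have {s1}s0' : 0 < s by rewrite lt_neqAle eq_sym s1.
have -> : r - s / 2 < r + s / 2 by lra.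
by congr (_%:E); lra.
Qed.

End euclidean_balls.

(** * Upper bound: diameters of pairs of balls and a convexity estimate *)

Section upper_bound.
Context {R : realType}.

(** Convexity of the [d]-th power: [1 - u / 2] is the combination of [1] and [1 / 2] with weights
    [1 - u] and [u]. *)
Lemma expr_chord_le (d : nat) (u : R) : 0 <= u <= 1 ->
  (1 - u / 2) ^+ d <= (1 - u) + u * 2^-1 ^+ d.
Proof.
move=> /andP[u0 u1]; elim: d => [|d IH]; first by rewrite !expr0; lra.
rewrite exprS; apply: le_trans (ler_wpM2l _ IH) _; first by lra.
rewrite exprS; set h := 2^-1 ^+ d.
have h1 : h <= 1 by rewrite exprn_ile1// invf_le1//; lra.
have : 0 <= u * (1 - u) * (1 - h) by rewrite !mulr_ge0//; lra.
by nra.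
Qed.

Lemma sum_expr_le (n d : nat) (s : 'I_n -> R) : (0 < d)%N ->
    (forall i, 0 < s i <= 1) -> (forall i j, i != j -> s i + s j <= 1) ->
  \sum_(i < n) s i ^+ d <= Num.max 1 (n%:R / 2 ^+ d).
Proof.
move=> d0 s01 sij; rewrite le_max -exprVn.
have [[i0 si0]|s_small] := pselect (exists i, 2^-1 < s i); last first.
  apply/orP; right; have -> : n%:R * 2^-1 ^+ d = \sum_(i < n) 2^-1 ^+ d :> R.
    by rewrite sumr_const card_ord mulr_natl.
  apply: ler_sum => i _; have /andP[? ?] := s01 i.
  have ? : s i <= 2^-1.
    by rewrite leNgt; apply/negP => si; apply: s_small; exists i.
  by rewrite lerXn2r// nnegrE; lra.
pose u := 2 * (1 - s i0).
have si0E : s i0 = 1 - u / 2 by rewrite /u; lra.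
have u01 : 0 <= u <= 1.
  by have /andP[? ?] := s01 i0; apply/andP; rewrite /u; split; lra.
(* Since [0 <= u <= 1] and [0 < d], the power [u ^+ d] is at most [u]; this makes the bound for the
   small balls linear in [u]. *)
have u0d : (u / 2) ^+ d <= u * 2^-1 ^+ d.
  rewrite exprMn ler_wpM2r ?exprn_ge0//; case: d d0 => // d _.
  have /andP[? ?] := u01.
  by rewrite exprS ler_piMr// exprn_ile1.
have : \sum_(i < n) s i ^+ d <= (1 - u) * 1 + u * (n%:R * 2^-1 ^+ d).
  rewrite (bigD1 i0)//= si0E.
  have : \sum_(i < n | i != i0) s i ^+ d <= \sum_(i < n | i != i0) (u * 2^-1 ^+ d).
    apply: ler_sum => i ii0; apply: le_trans u0d.
    have := sij _ _ ii0; have /andP[? ?] := s01 i => ?.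
    by rewrite lerXn2r ?nnegrE//; lra.
  rewrite sumr_const.
  have -> : #|[pred i | i != i0]| = n.-1.
    by have := cardC1 i0; rewrite card_ord.
  have := expr_chord_le d u01.
  have n0 : (0 < n)%N by case: (i0) => m; case: (n).
  rewrite -[in n%:R](prednK n0) -natr1 -[_ *+ n.-1]mulr_natl.
  by move=> *; lra.
have /andP[u0 u1] := u01.
(* The combination of [1] and [X] with weights [1 - u] and [u] is at most the larger of the two. *)
set X := n%:R * _ => sumX.
have [X1|X1] := leP X 1.
  apply/orP; left; apply: le_trans sumX _; nra.
apply/orP; right; apply: le_trans sumX _; nra.
Qed.

Lemma disjoint_diameters_le (d n : nat) (c : 'I_n -> 'rV[R]_d) (s : 'I_n -> R) :
    (forall i, 0 < s i) -> trivIset setT (fun i => oball (c i) (s i)) ->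
    line_bounded (\bigcup_i oball (c i) (s i)) ->
  forall i j, i != j -> s i + s j <= 1.
Proof.
move=> s0 tI lb i j ij.
have disj x : oball (c i) (s i) x -> oball (c j) (s j) x -> False.
  move=> xi xj; move/eqP : ij; apply.
  by apply: tI => //; exists x.
(* Coinciding centres would be a common point of two disjoint balls, so the line through the centres
   is well defined. *)
have D0 : 0 < enorm (c j - c i).
  rewrite lt_neqAle enorm_ge0 andbT eq_sym; apply/eqP => /enorm_eq0/eqP.
  rewrite subr_eq0 => /eqP cij; apply: (disj (c i)); last rewrite -cij;
    exact: oball_center.
set D := enorm _ in D0; pose v := D^-1 *: (c j - c i).
have v1 : enorm v = 1 by rewrite enormZ gtr0_norm ?invr_gt0// mulVf ?gt_eqF.
have li : line_length (c i) v (oball (c i) (s i)) = (s i)%:E.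
  by rewrite -[X in line_length X](subr0) -(scale0r v) line_length_oball_center// ltW.
have lj : line_length (c i) v (oball (c j) (s j)) = (s j)%:E.
  have -> : c i = c j - D *: v.
    by rewrite scalerA divff ?gt_eqF// scale1r opprB addrC subrK.
  by rewrite line_length_oball_center// ltW.
rewrite -lee_fin EFinD -li -lj; apply: le_trans (lb (c i) v v1).
have mo k : measurable [set t : R | oball (c k) (s k) (c i + t *: v)].
  by apply: measurable_oball_line => //; exact: ltW.
rewrite -measureU; [|exact: mo|exact: mo|]; last first.
  by apply/seteqP; split => t // [] /disj.
rewrite /line_length; apply: le_measure; rewrite ?inE.
- by apply: measurableU; exact: mo.
- rewrite (_ : mkset _ = \bigcup_k [set t : R | oball (c k) (s k) (c i + t *: v)]).
    by apply: fin_bigcup_measurable => [|k _]; [exact: finite_finset|exact: mo].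
  by apply/seteqP; split => t [k _ ?]; exists k.
- by move=> t [] ?; [exists i|exists j].
Qed.

Lemma ell_le (d n : nat) : (0 < d)%N ->
  (ell R d n <= (Num.max 1 (n%:R / 2 ^+ d))%:E * lebesgue_d (@oball R d 0 1))%E.
Proof.
move=> d0; apply: ub_ereal_sup => _ [P [[c [s [s01 tI ->]]] lb] <-].
have s0 i : 0 < s i by case/andP: (s01 i).
apply: le_trans (lebesgue_d_bigcup _ d0) _.
under eq_bigr do rewrite lebesgue_d_oball//.
rewrite -ge0_sume_distrl; last by move=> i _; rewrite lee_fin exprn_ge0// ltW.
rewrite lee_wpmul2r ?lebesgue_d_ge0// sumEFin lee_fin sum_expr_le//.
exact: (disjoint_diameters_le s0 tI lb).
Qed.

End upper_bound.

(** * Lower bound: one dominant ball, and balls along an exponential curve *)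

Section lower_bound.
Context {R : realType}.

Lemma line_length_bigcup_oball (d n : nat) (c : 'I_n -> 'rV[R]_d) (s : 'I_n -> R)
    (p v : 'rV[R]_d) : enorm v = 1 -> (forall i, 0 <= s i) ->
  (line_length p v (\bigcup_i oball (c i) (s i)) <=
   \sum_(i < n) line_length p v (oball (c i) (s i)))%E.
Proof.
move=> v1; elim: n c s => [|n IH] c s s0.
  rewrite big_ord0 /line_length (_ : mkset _ = set0) ?measure0//.
  by apply/seteqP; split => // t [[]].
rewrite big_ord_recl.
apply: le_trans (leeD (le_refl _) (IH (c \o lift ord0) (s \o lift ord0) _)); last first.
  by move=> i; exact: s0.
have mo k : measurable [set t : R | oball (c k) (s k) (p + t *: v)].
  exact: measurable_oball_line.
set A := \bigcup_i oball (c (lift ord0 i)) (s (lift ord0 i)).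
have mA : measurable [set t : R | A (p + t *: v)].
  rewrite (_ : mkset _ = \bigcup_(i : 'I_n)
      [set t : R | oball (c (lift ord0 i)) (s (lift ord0 i)) (p + t *: v)]).
    by apply: fin_bigcup_measurable => [|k _]; [exact: finite_finset|exact: mo].
  by apply/seteqP; split => t [k _ ?]; exists k.
rewrite /line_length.
rewrite (_ : mkset _ = [set t : R | oball (c ord0) (s ord0) (p + t *: v)] `|`
   [set t : R | A (p + t *: v)]); first by apply: measureU2 => //; exact: mo.
apply/seteqP; split => t.
  move=> [i _]; case: (unliftP ord0 i) => [j ->|->] Fx; last by left.
  by right; exists j.
by move=> [?|[j _ ?]]; [exists ord0|exists (lift ord0 j)].
Qed.

(** Along the axis [i0] the centres are at least 1 apart and the radii are at most [1 / 2], so the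
    open projections onto that axis are already disjoint. *)
Lemma trivIset_oball (d n : nat) (i0 : 'I_d) (c : 'I_n -> 'rV[R]_d) (s : 'I_n -> R) :
    (forall i, c i ord0 i0 = i%:R) -> (forall i, s i <= 1) ->
  trivIset setT (fun i => oball (c i) (s i)).
Proof.
move=> cE s1 i j _ _ [x [/(oball_coord i0) xi /(oball_coord i0) xj]].
move: xi xj; rewrite !cE !ltr_norml => /andP[? ?] /andP[? ?].
have si := s1 i; have sj := s1 j.
by apply/val_inj/eqP; rewrite /= eqn_leq; apply/andP; split;
  rewrite -ltnS -(ltr_nat R) -natr1; lra.
Qed.

(** The line bound holds for every line because the diameters sum to at most 1. Letting [e] tend to
    0 then gives the unit-diameter ball as a limit. *)
Lemma lebesgue_d_oball1_le_ell (d n : nat) : (0 < d)%N -> (0 < n)%N ->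
  (lebesgue_d (@oball R d 0 1) <= ell R d n)%E.
Proof.
case: n => // n d0 _.
have [b0 bfin] := (lebesgue_d_ge0 (@oball R d 0 1), @lebesgue_d_oball_fin R d d0).
have ell_ge e : 0 < e < 1 ->
    (((1 - e) ^+ d)%:E * lebesgue_d (@oball R d 0 1) <= ell R d n.+1)%E.
  move=> /andP[e0 e1].
  have [q [q0 qe nq]] : exists q : R, [/\ 0 < q, q <= e & n%:R * q <= e].
    exists (e / n.+1%:R); split; first by rewrite divr_gt0.
      by rewrite ler_pdivrMr// ler_peMr// ?ler1n// ltW.
    by rewrite mulrCA ler_piMr ?ltW// ltr_pdivrMr// mul1r ltr_nat.
  pose c (i : 'I_n.+1) : 'rV[R]_d := const_mx i%:R.
  pose s (i : 'I_n.+1) : R := if i == ord0 then 1 - e else q.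
  have s0 i : 0 < s i by rewrite /s; case: ifP => _; lra.
  have s1 i : s i <= 1 by rewrite /s; case: ifP => _; lra.
  apply: (@le_trans _ _ (lebesgue_d (\bigcup_i oball (c i) (s i)))).
    apply: (@le_trans _ _ (lebesgue_d (oball (c ord0) (s ord0)))).
      by rewrite (lebesgue_d_oball _ (s0 _)) /s eqxx.
    by apply: le_lebesgue_d => x ?; exists ord0.
  apply: ereal_sup_ubound; exists (\bigcup_i oball (c i) (s i)) => //; split.
    exists c, s; split => // [i|]; first by rewrite s0 s1.
    by apply: (trivIset_oball (i0 := Ordinal d0)) => // i; rewrite mxE.
  move=> p v v1; have s0' i := ltW (s0 i).
  apply: le_trans (line_length_bigcup_oball c p v1 s0') _.
  apply: (@le_trans _ _ (\sum_i (s i)%:E)%E).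
    by apply: lee_sum => i _; exact: line_length_oball_le.
  rewrite sumEFin lee_fin big_ord_recl /s eqxx/= sumr_const card_ord.
  rewrite -[_ *+ n]mulr_natl.
  lra.
rewrite -(fineK bfin) in b0 ell_ge *; set b := fine _ in b0 ell_ge *.
rewrite lee_fin in b0.
apply/lee_addgt0Pr => e e0.
(* The bound [1 / 2] keeps [f] in the open unit interval; the other one makes the loss [d * f * b]
   at most [e], the [+ 1] keeping the denominator positive. *)
pose f := Num.min 2^-1 (e / (d%:R * b + 1)).
have db0 : 0 <= d%:R * b by rewrite mulr_ge0.
have f01 : 0 < f < 1.
  rewrite /f lt_min gt_min divr_gt0//; last by lra.
  by rewrite invr_gt0 ltr0n/=; apply/orP; left; lra.
have fle : f <= e / (d%:R * b + 1) by rewrite /f ge_min lexx orbT.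
have := ell_ge f f01; clearbody f.
set L := ell R d n.+1 => Lf.
(* Bernoulli's inequality. *)
have bern m : 1 - m%:R * f <= (1 - f) ^+ m.
  elim: m => [|m IH]; first by rewrite expr0 mul0r subr0.
  have f1 : 0 <= 1 - f by lra.
  rewrite exprS; apply: le_trans (ler_wpM2l f1 IH).
  have : 0 <= m%:R * f ^+ 2 by rewrite mulr_ge0// sqr_ge0.
  by rewrite -natr1; lra.
have fe : d%:R * f * b <= e.
  rewrite mulrAC; apply: (@le_trans _ _ ((d%:R * b + 1) * (e / (d%:R * b + 1)))).
    by apply: ler_pM => //; lra.
  by rewrite mulrC divfK// gt_eqF//; lra.
rewrite -[b](subrK e) EFinD leeD2r//; apply: le_trans Lf.
rewrite -EFinM lee_fin; apply: le_trans (ler_wpM2r b0 (bern d)).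
by rewrite mulrBl; lra.
Qed.

(* The slope between the last two points exceeds the one between the first two. *)
Lemma collinear_exp_false (n i j k : nat) (a b v w t1 t2 t3 : R) :
    (i < j < k)%N -> (k < n)%N ->
    `|a + t1 * v - i%:R| < 4^-1 -> `|b + t1 * w - (2 * n%:R + 3) ^+ i| < 4^-1 ->
    `|a + t2 * v - j%:R| < 4^-1 -> `|b + t2 * w - (2 * n%:R + 3) ^+ j| < 4^-1 ->
    `|a + t3 * v - k%:R| < 4^-1 -> `|b + t3 * w - (2 * n%:R + 3) ^+ k| < 4^-1 ->
  False.
Proof.
move=> /andP[ij jk] kn; rewrite !ltr_norml.
set K := _ + 3; set N := n%:R in K *; have N0 : 0 <= N by [].
have K1 : 1 <= K by rewrite /K; lra.
have Ki : 1 <= K ^+ i by rewrite exprn_ege1.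
have Zj : 1 <= K ^+ j by rewrite exprn_ege1.
have Kk : K * K ^+ j <= K ^+ k by rewrite -exprS ler_weXn2l.
have rij : i%:R + 1 <= j%:R :> R by rewrite natr1 ler_nat.
have rjk : j%:R + 1 <= k%:R :> R by rewrite natr1 ler_nat.
have rkn : k%:R + 1 <= N by rewrite natr1 ler_nat.
have rj : 0 <= j%:R :> R by [].
have ri : 0 <= i%:R :> R by [].
set Z := K ^+ j in Zj Kk *; set I := i%:R in rij ri *.
set J := j%:R in rij rjk rkn rj *; set L := k%:R in rjk rkn *.
set Zi := K ^+ i in Ki *; set Zk := K ^+ k in Kk *.
(* Equality of the two slopes of three collinear points, written without division. *)
have colin : ((a + t2 * v) - (a + t1 * v)) * ((b + t3 * w) - (b + t2 * w)) =
   ((a + t3 * v) - (a + t2 * v)) * ((b + t2 * w) - (b + t1 * w)) by ring.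
set X1 := a + t1 * v in colin *; set X2 := a + t2 * v in colin *.
set X3 := a + t3 * v in colin *; set Y1 := b + t1 * w in colin *.
set Y2 := b + t2 * w in colin *; set Y3 := b + t3 * w in colin *.
move=> /andP[? ?] /andP[? ?] /andP[? ?] /andP[? ?] /andP[? ?] /andP[? ?].
have dX : 2^-1 <= X2 - X1 by lra.
have dY : (2 * N + 2 - 2^-1) * Z <= Y3 - Y2 by rewrite /K in Kk; lra.
have dX' : X3 - X2 <= N + 2^-1 by lra.
have dY' : Y2 - Y1 <= Z by lra.
(* The left product is at least [(N + 3/4) * Z], whereas the right one will be at most
   [(N + 1/2) * Z], which is a contradiction as [Z] is positive. *)
have l1 : 2^-1 * ((2 * N + 2 - 2^-1) * Z) <= (X2 - X1) * (Y3 - Y2).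
  by apply: ler_pM => //; rewrite ?invr_ge0// mulr_ge0//; lra.
have : (X3 - X2) * (Y2 - Y1) <= (N + 2^-1) * Z.
  have dX3 : 0 <= X3 - X2 by lra.
  by apply: le_trans (ler_wpM2l dX3 dY') _; rewrite ler_wpM2r//; lra.
rewrite -colin; lra.
Qed.

Lemma half_balls_le_ell (d n : nat) : (1 < d)%N ->
  ((n%:R * 2^-1 ^+ d)%:E * lebesgue_d (@oball R d 0 1) <= ell R d n)%E.
Proof.
move=> d1; pose i0 := Ordinal (ltnW d1); pose i1 := Ordinal d1.
pose K : R := 2 * n%:R + 3.
pose c k : 'rV[R]_d := \row_m if m == i1 then K ^+ k else k%:R.
have c0 k : c k ord0 i0 = k%:R by rewrite mxE.
have c1 k : c k ord0 i1 = K ^+ k by rewrite mxE eqxx.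
pose P := \bigcup_(i : 'I_n) oball (c i) 2^-1.
have h01 : 0 < (2^-1 : R) <= 1 by apply/andP; split; lra.
have /andP[h0 h1] := h01.
have volP : ((n%:R * 2^-1 ^+ d)%:E * lebesgue_d (@oball R d 0 1) <= lebesgue_d P)%E.
  (* The ball around [c k] has radius [1 / 4], so it fits into the slab of width 1 centred at [k];
     consecutive slabs share their boundary height. *)
  have slab k x : oball (c k) 2^-1 x -> k%:R - 2^-1 < x ord0 i0 <= k.+1%:R - 2^-1.
    move=> /(oball_coord i0); rewrite c0 ltr_norml => /andP[? ?].
    by rewrite -[k.+1%:R]natr1; apply/andP; split; lra.
  apply: le_trans (le_trans (lebesgue_d_slabs n (i0 := i0) _ slab) _).
  - under eq_bigr do rewrite lebesgue_d_oball//.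
    rewrite -ge0_sume_distrl; last by move=> i _; rewrite lee_fin exprn_ge0// ltW.
    by rewrite sumEFin sumr_const card_ord mulr_natl.
  - by move=> k m km; rewrite lerD2r ler_nat.
  - by apply: le_lebesgue_d => x [k /= kn xk]; exists (Ordinal kn).
apply: le_trans volP _; apply: ereal_sup_ubound; exists P => //; split.
  exists (fun i : 'I_n => c i), (fun=> 2^-1); split => //.
  exact: (trivIset_oball (i0 := i0)).
move=> p v v1.
apply: le_trans (line_length_bigcup_oball (fun i : 'I_n => c i) p v1 (fun=> ltW h0)) _.
pose meets (i : 'I_n) := exists t : R, oball (c i) 2^-1 (p + t *: v).
(* Only the balls met by the line contribute, each at most [1 / 2], so it is enough that [S] has at
   most two elements. *)
pose S := [set i : 'I_n | `[< meets i >]]%SET.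
have meets_coord i : i \in S -> exists t,
    `|p ord0 i0 + t * v ord0 i0 - i%:R| < 4^-1 /\
    `|p ord0 i1 + t * v ord0 i1 - K ^+ i| < 4^-1.
  have -> : 4^-1 = 2^-1 / 2 :> R by lra.
  rewrite inE => /asboolP[t ti]; exists t; have := (oball_coord i0 ti, oball_coord i1 ti).
  by rewrite c0 c1 !mxE => -[].
have no3 (i j k : 'I_n) : i \in S -> j \in S -> k \in S -> (i < j < k)%N -> False.
  move=> /meets_coord[t1 [? ?]] /meets_coord[t2 [? ?]] /meets_coord[t3 [? ?]] ijk.
  by apply: (collinear_exp_false ijk (ltn_ord k)); eassumption.
have S2 : (#|S| <= 2)%N.
  rewrite leqNgt; apply/negP => /card_gt2P[i [j [k [[iS jS kS] [ij jk ki]]]]].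
  (* Three distinct indices can be sorted; the two cyclic orders are impossible and the other six
     contradict [no3]. *)
  move: ij jk ki; rewrite -!val_eqE/=.
  case: (ltngtP i j) => // ij _; case: (ltngtP j k) => // jk _;
    case: (ltngtP k i) => // ki _.
  - by have := ltn_trans (ltn_trans ij jk) ki; rewrite ltnn.
  - by apply: (no3 i j k); rewrite // ij.
  - by apply: (no3 k i j); rewrite // ki.
  - by apply: (no3 i k j); rewrite // ki.
  - by apply: (no3 j k i); rewrite // jk.
  - by apply: (no3 j i k); rewrite // ij.
  - by apply: (no3 k j i); rewrite // jk.
  - by have := ltn_trans (ltn_trans ki jk) ij; rewrite ltnn.
apply: (@le_trans _ _ (\sum_(i in S) (2^-1)%:E)%E).
  rewrite [leRHS]big_mkcond/=; apply: lee_sum => i _; case: ifPn => iS.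
    by apply: line_length_oball_le => //; exact: ltW.
  rewrite /line_length (_ : mkset _ = set0) ?measure0//.
  apply/seteqP; split => // t ti; move/negP: iS; apply.
  by rewrite inE; apply/asboolP; exists t.
rewrite sumEFin lee_fin sumr_const -[_ *+ _]mulr_natl.
have : #|S|%:R <= 2 :> R by rewrite (ler_nat R _ 2).
by lra.
Qed.

End lower_bound.

Theorem theorem2 (R : realType) (n d : nat) (hn : (1 <= n)%N) (hd : (2 <= d)%N) :
  ell R d n = ((Num.max 1 (n%:R / 2 ^+ d))%:E * lebesgue_d (@oball R d 0 1))%E.
Proof.
have d0 : (0 < d)%N by exact: ltnW.
apply/eqP; rewrite eq_le ell_le//=.
rewrite /Num.max; case: ifP => _; last by rewrite mul1e lebesgue_d_oball1_le_ell.
by rewrite -exprVn half_balls_le_ell.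
Qed.
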